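(* Let $X$ be a separable second countable topological space endowed with a partial action of a Hausdorff topological group $G$. Then the following assertions are equivalent: (i) $X/\!\sim_G$ is metrizable; (ii) $X/\!\sim_G$ is regular and $T_1$.
   Context: A partial action of $G$ on $X$ is a function $\eta:G*X\to X$ with domain $G*X\subseteq G\times X$, written $g\cdot x=\eta(g,x)$, where ''$\exists g\cdot x$'' means $(g,x)\in G*X$, such that for all $g,h\in G$, $x\in X$: (PA1) if $\exists g\cdot x$ then $\exists g^{-1}\cdot(g\cdot x)$ and $g^{-1}\cdot(g\cdot x)=x$; (PA2) if $\exists g\cdot(h\cdot x)$ (in particular $\exists h\cdot x$) then $\exists (gh)\cdot x$ and $g\cdot(h\cdot x)=(gh)\cdot x$; (PA3) $\exists 1\cdot x$ and $1\cdot x=x$. Put $X_g=\{x\in X\mid \exists g^{-1}\cdot x\}$ and let $\eta_g:X_{g^{-1}}\to X_g$, $x\mapsto g\cdot x$, which is a bijection. All partial actions are assumed topological: every $X_g$ is open in $X$ and every $\eta_g$ is a homeomorphism. Orbit equivalence relation: $x\sim_G y$ iff there is $g\in G$ with $\exists g\cdot x$ and $g\cdot x=y$; the orbit space $X/\!\sim_G$ has the quotient topology. *)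

(* Defs.v *)
From HB Require Import structures.
From mathcomp Require Import all_boot all_order all_algebra.
From mathcomp Require Import all_classical all_reals topology.

Set Implicit Arguments.
Unset Strict Implicit.
Unset Printing Implicit Defensive.

Local Open Scope quotient_scope.
Local Open Scope classical_set_scope.
Local Open Scope group_scope.

HB.structure Definition PreTopologicalGroup := {G of Topological G & Group G}.

HB.mixin Record PreTopologicalGroup_isTopologicalGroup G
    & PreTopologicalGroup G := {
  mulg_continuous : continuous (fun z : G * G => z.1 * z.2) ;
  invg_continuous : continuous (fun x : G => x^-1)
}.

#[short(type="topologicalGroupType")]
HB.structure Definition TopologicalGroup :=
  {G of PreTopologicalGroup G & PreTopologicalGroup_isTopologicalGroup G}.

Definition separable_space (T : topologicalType) : Prop :=
  exists2 D : set T, countable D & dense D.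

(* The metric structure m carries its own topology on T, which is required to
   be the given one. *)
Definition metrizable (R : realType) (T : topologicalType) : Prop :=
  exists m : Metric R T,
    forall A : set T, open A <-> @open (Metric.Pack m) A.

Definition homeomorphism_between (T U : topologicalType) (A : set T)
    (B : set U) (f : T -> U) : Prop :=
  exists f' : U -> T,
    [/\ {homo f : x / A x >-> B x}, {homo f' : y / B y >-> A y},
        (forall x, A x -> f' (f x) = x) & (forall y, B y -> f (f' y) = y)] /\
    ({within A, continuous f} /\ {within B, continuous f'}).

(* A partial function G * X -> X is encoded by its domain together with a total
   function whose values outside the domain are irrelevant. *)
Record partial_action (G : groupType) (X : Type) := PartialAction {
  pact_dom : set (G * X) ;
  pact : G -> X -> X ;
  pactVK : forall g x, pact_dom (g, x) ->
    pact_dom (g^-1, pact g x) /\ pact g^-1 (pact g x) = x ;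
  pactM : forall g h x, pact_dom (h, x) -> pact_dom (g, pact h x) ->
    pact_dom (g * h, x) /\ pact g (pact h x) = pact (g * h) x ;
  pact1 : forall x, pact_dom (1, x) /\ pact 1 x = x
}.

(* The set X_g. *)
Definition pact_set (G : groupType) (X : Type) (eta : partial_action G X)
    (g : G) : set X :=
  [set x | pact_dom eta (g^-1, x)].

(* No joint continuity of eta in (g, x), nor openness of its domain in G * X,
   is required. *)
Definition topological_partial_action (G : groupType) (X : topologicalType)
    (eta : partial_action G X) : Prop :=
  forall g : G, open (pact_set eta g) /\
    homeomorphism_between (pact_set eta g^-1) (pact_set eta g) (pact eta g).

Definition orbit_rel (G : groupType) (X : Type) (eta : partial_action G X)
    (x y : X) : Prop :=
  exists g : G, pact_dom eta (g, x) /\ pact eta g x = y.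

Section orbit_space.
Context {G : groupType} {X : topologicalType} (eta : partial_action G X).

Definition orbit_relb : rel X := fun x y => `[< orbit_rel eta x y >].

Lemma orbit_relb_refl : reflexive orbit_relb.
Proof. by move=> x; apply/asboolP; exists 1; exact: pact1. Qed.

Lemma orbit_relb_sym : symmetric orbit_relb.
Proof.
have sub x y : orbit_rel eta x y -> orbit_rel eta y x.
  by move=> [g [gx <-]]; exists g^-1; exact: pactVK.
by move=> x y; apply/asboolP/asboolP; exact: sub.
Qed.

Lemma orbit_relb_trans : transitive orbit_relb.
Proof.
move=> y x z /asboolP[h [hx hxy]] /asboolP[g [gy gyz]]; apply/asboolP.
subst y; have [ghx E] := pactM hx gy.
by exists (g * h); split=> //; rewrite -E.
Qed.

Definition orbit_equiv : equiv_rel X :=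
  EquivRel orbit_relb orbit_relb_refl orbit_relb_sym orbit_relb_trans.

Definition orbit_space : topologicalType :=
  quotient_topology {eq_quot orbit_equiv}.

End orbit_space.

(* Main.v *)
From HB Require Import structures.
Require Import Defs.
From mathcomp Require Import all_boot all_order all_algebra.
From mathcomp Require Import all_classical all_reals topology.
From mathcomp Require Import interval_inference normedtype lra.

Import Order.TTheory GRing.Theory Num.Theory.
Import numFieldNormedType.Exports.

Local Open Scope classical_set_scope.
Local Open Scope ring_scope.

(** A metric topology is always regular and Hausdorff, so only the converse has
content.  Saturating an open set A under the partial action gives the union
over g of the sets of points x of the domain of g with g x in A; each of these
is open since the partial action is topological.  Hence the quotient map is
open, and it carries a countable basis of X to a countable basis of the orbit
space.  It remains to prove Urysohn's metrization theorem
([regular_sequential_basis_metrizable]) and to apply it to the orbit space.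

For Urysohn's theorem, let b be a countable basis of a regular T1 space.
Regularity is upgraded to normality by the usual staircase construction
([regular_sequential_basis_separation]).  Urysohn's lemma then attaches to each
pair of basic sets with [closure (b k) `<=` b m] a continuous function that is
0 on the first and 1 off the second.  These countably many functions
separate points from closed sets, and the supremum of the weighted
differences [n.+1%:R^-1 * `|F n x - F n y|] is a metric for the topology
([family_metrizable]): a single function already confines small balls to a
given neighbourhood, while, for a given radius, the weights leave only finitely
many functions to control. *)

(** * Countable bases as sequences *)

Definition sequential_basis (T : topologicalType) (b : nat -> set T) : Prop :=
  (forall n, open (b n)) /\
  forall x V, open V -> V x -> exists2 n, b n x & b n `<=` V.

Lemma second_countable_sequential_basis (T : topologicalType) :
  @second_countable T -> exists b : nat -> set T, sequential_basis T b.
Proof.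
move=> [B cB [oB bB]].
have bV x V : open V -> V x -> exists2 U, B U & U x /\ U `<=` V.
  move=> oV Vx; have [|U [BU Ux] UV] := bB x V; first exact: open_nbhs_nbhs.
  by exists U.
have [B0|[f]] := pfcard_geP cB.
  (* An empty basis forces an empty space. *)
  exists (fun=> set0); split=> [n|x V oV Vx]; first exact: open0.
  by have [U] := bV x V oV Vx; rewrite B0.
exists f; split=> [n|x V oV Vx]; first by apply: oB; exact: funS.
have [U BU [Ux UV]] := bV x V oV Vx.
have [n _ nU] : (f @` setT) U by exact: surj.
by exists n; rewrite nU.
Qed.

Lemma image_sequential_basis (X Y : topologicalType) (f : X -> Y)
    (b : nat -> set X) :
  continuous f -> (forall A, open A -> open (f @` A)) ->
  (forall y, exists x, f x = y) ->
  sequential_basis X b -> sequential_basis Y (fun n => f @` b n).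
Proof.
move=> cf of_ sf [ob bV]; split=> [n|y V oV]; first exact: of_.
have [x <-] := sf y => Vfx.
have [|//|n bx bfV] := bV x (f @^-1` V).
  by move/continuousP: cf; exact.
by exists n; [exists x|move=> _ [z /bfV Vz <-]].
Qed.

(** * Normality *)

(** With [I D] the indices of the basic sets whose closure misses D, regularity
says that C is covered by the basic sets with index in [I D] whenever C and D
are closed and disjoint.  Removing from [b n] the closures of the sets [b k]
with k <= n and k in [I C] keeps C covered, leaves an open set because only
finitely many closed sets are removed, and makes the two resulting unions
disjoint: of a set [b n] in one union and a set [b m] in the other, the one
with the larger index has lost all points of the other. *)
Lemma regular_sequential_basis_separation (T : topologicalType)
    (b : nat -> set T) (A B : set T) :
  sequential_basis T b -> regular_space T ->
  closed A -> closed B -> A `&` B = set0 ->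
  exists U V, [/\ open U, open V, A `<=` U, B `<=` V & U `&` V = set0].
Proof.
move=> [ob bV] regT cA cB AB0.
pose I (D : set T) : set nat := [set n | closure (b n) `<=` ~` D].
pose W (C D : set T) := \bigcup_(n in I D)
  (b n `\` \bigcup_(k in [set k | (k <= n)%N] `&` I C) closure (b k)).
have oW C D : open (W C D).
  apply: bigcup_open => n _; apply: openI; first exact: ob.
  rewrite openC; apply: closed_bigcup => [|k _]; last exact: closed_closure.
  apply: finite_setIl; apply: (sub_finite_set _ (finite_II n.+1)).
  by move=> k /=; rewrite ltnS.
have subW C D : closed D -> C `&` D = set0 -> C `<=` W C D.
  move=> cD /disjoints_subset CD x Cx.
  have [|V nV VD] := regT x (~` D).
    by apply: open_nbhs_nbhs; split; [rewrite openC|exact: CD].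
  have [n bx bnV] := bV x V° (open_interior V) nV.
  exists n.
    apply: subset_trans VD; apply: closureS.
    exact: subset_trans bnV (@interior_subset _ _).
  by split=> // -[k [_ Ik] /Ik]; exact.
exists (W A B), (W B A); split=> //; [exact: subW| |].
  by apply: subW => //; rewrite setIC.
rewrite -subset0 => x [[n In [bn nn]] [m Im [bm nm]]].
case: (leqP n m) => [nlem|/ltnW mlen].
  by apply: nm; exists n => //; exact: subset_closure.
by apply: nn; exists m => //; exact: subset_closure.
Qed.

(** * The metric of a separating sequence of functions *)

Section family_dist.
Context (R : realType) (T : choiceType) (F : nat -> T -> R).
Hypothesis F1 : forall n x y, `|F n x - F n y| <= 1.

Let wdiff x y n : R := n.+1%:R^-1 * `|F n x - F n y|.

Definition family_dist (x y : T) : R := sup (range (wdiff x y)).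

Let wdiff_le x y n : wdiff x y n <= n.+1%:R^-1.
Proof. by rewrite ler_piMr// invr_ge0. Qed.

Lemma ge_family_dist x y n : n.+1%:R^-1 * `|F n x - F n y| <= family_dist x y.
Proof.
apply: ub_le_sup; last by exists n.
exists 1 => _ [m _ <-]; apply: (le_trans (wdiff_le x y m)).
by rewrite invf_le1// ler1n.
Qed.

Lemma family_dist_le x y e :
  (forall n, n.+1%:R^-1 * `|F n x - F n y| <= e) -> family_dist x y <= e.
Proof.
move=> le_e; apply: ge_sup => [|_ [n _ <-]]; last exact: le_e.
by exists (wdiff x y 0); exists 0%N.
Qed.

Lemma family_distxx x : family_dist x x = 0.
Proof.
apply/eqP; rewrite eq_le; apply/andP; split.
  by apply: family_dist_le => n; rewrite subrr normr0 mulr0.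
by have := ge_family_dist x x 0; rewrite subrr normr0 mulr0.
Qed.

Lemma family_dist_sym x y : family_dist x y = family_dist y x.
Proof.
rewrite /family_dist (_ : wdiff x y = wdiff y x)//.
by apply/funext => n; rewrite /wdiff distrC.
Qed.

Lemma family_dist_triangle y x z :
  family_dist x z <= family_dist x y + family_dist y z.
Proof.
apply: family_dist_le => n.
apply: le_trans (lerD (ge_family_dist x y n) (ge_family_dist y z n)).
by rewrite -mulrDr; apply: ler_wpM2l; rewrite ?invr_ge0// ler_distD.
Qed.

Hypothesis Fsep : forall x y, x != y -> exists n, F n x != F n y.

Lemma family_dist_positivity x y : family_dist x y = 0 -> x = y.
Proof.
move=> d0; apply/eqP/negPn/negP => /Fsep[n nFxy].
have := ge_family_dist x y n; rewrite d0 leNgt => /negP; apply.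
by rewrite mulr_gt0 ?invr_gt0// normr_gt0 subr_eq0.
Qed.

(** The carrier mentions both hypotheses so that the metric structure declared
on it, which depends on them, can be inferred. *)
Definition family_space : Type := let _ := F1 in let _ := Fsep in T.

HB.instance Definition _ := Choice.on family_space.
HB.instance Definition _ := isMetric.Build R family_space
  family_distxx family_dist_positivity family_dist_sym family_dist_triangle.

End family_dist.

Lemma near_all_lt (T : topologicalType) (x : T) (P : nat -> set T) (N : nat) :
  (forall n, nbhs x (P n)) -> \forall y \near x, forall n, (n < N)%N -> P n y.
Proof.
move=> nP; elim: N => [|N IH]; first exact: nearW.
apply: filterS2 IH (nP N) => y IHy PNy n.
by rewrite ltnS leq_eqVlt => /orP[/eqP->|/IHy].
Qed.

(** The weighted supremum metric induces the topology.  An open set around x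
contains a ball because one function F n separates x from its complement; the
radius only has to absorb the weight of F n.  Conversely, the ball of radius e
is a neighbourhood: from some rank N on the weights alone are below e / 2, and
the first N functions vary by less than e / 2 near x by continuity. *)
Lemma family_metrizable (R : realType) (T : topologicalType)
    (F : nat -> T -> R) :
  accessible_space T ->
  (forall n, continuous (F n)) ->
  (forall n x y, `|F n x - F n y| <= 1) ->
  (forall x V, open V -> V x ->
    exists n, exists2 e, 0 < e & forall y, `|F n x - F n y| < e -> V y) ->
  metrizable R T.
Proof.
move=> acc cF F1 FV.
have Fsep x y : x != y -> exists n, F n x != F n y.
  move=> /acc[A [oA /set_mem Ax /set_mem nAy]].
  have [n [e e0 FA]] := FV x A oA Ax; exists n; apply/eqP => Fxy.
  by apply: nAy; apply: FA; rewrite Fxy subrr normr0.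
pose M : metricType R := family_space R T F F1 Fsep.
exists (Metric.class M) => A; rewrite (@openE T) (@openE M).
have nE (x : T) : @nbhs T T x A <-> @nbhs M M x A.
  split.
    rewrite nbhsE => -[V [oV Vx] VA]; have [n [e e0 FVe]] := FV x V oV Vx.
    apply/nbhs_ballP; exists (n.+1%:R^-1 * e).
      by rewrite /= mulr_gt0// invr_gt0.
    move=> y; rewrite ballEmdist /= => dxy; apply/VA/FVe.
    rewrite -(@ltr_pM2l _ n.+1%:R^-1) ?invr_gt0//.
    exact: le_lt_trans (ge_family_dist _ _ _ F1 x y n) dxy.
  move=> /nbhs_ballP[e /= e0 eA].
  have e20 : 0 < e / 2 by rewrite divr_gt0.
  have [N _ Ne] := near_infty_natSinv_lt (PosNum e20).
  have nF n : nbhs x [set y | `|F n x - F n y| < e / 2].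
    by have /cvgrPdist_lt := cF n x; apply.
  apply: filterS (near_all_lt T x _ N nF) => y Fxy.
  apply: eA; rewrite ballEmdist /=.
  apply: (@le_lt_trans _ _ (e / 2)); last first.
    by rewrite ltr_pdivrMr// ltr_pMr// ltr1n.
  apply: family_dist_le => n; have [nN|Nn] := ltnP n N.
    apply: le_trans (ltW (Fxy n nN)).
    by rewrite ler_piMl// invf_le1// ler1n.
  apply: le_trans (ltW (Ne n Nn)).
  by rewrite ler_piMr// invr_ge0.
by split=> oA x /oA; [move/(nE x)|move/(nE x)].
Qed.

(** * Urysohn's metrization theorem *)

(** Normality gives one Urysohn function per pair (k, m) of indices with
[closure (b k) `<=` b m]; regularity supplies such a pair between a point and
any open set around it. *)
Lemma regular_sequential_basis_metrizable (R : realType)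
    (T : topologicalType) (b : nat -> set T) :
  sequential_basis T b -> regular_space T -> accessible_space T ->
  metrizable R T.
Proof.
move=> basb regT acc; have [ob bV] := basb.
have normT : normal_space T.
  apply/(@normal_openP R) => A B.
  exact: regular_sequential_basis_separation basb regT.
(* Pairs that are not nested receive the constant 0, which keeps f total. *)
pose good p := closure (b p.1) `<=` b p.2.
have Urys p : exists f : T -> R, [/\ continuous f, range f `<=` `[0, 1] &
    good p ->
    f @` closure (b p.1) `<=` [set 0] /\ f @` (~` b p.2) `<=` [set 1]].
  have [gp|ngp] := pselect (good p); last first.
    exists (fun=> 0); split=> // [x|_ [x _ <-]]; first exact: cvg_cst.
    by rewrite /= in_itv /= lexx ler01.
  have : uniform_separator (closure (b p.1)) (~` b p.2).
    apply: (iffLR (@normal_separatorP R T) normT).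
    - exact: closed_closure.
    - by rewrite closedC.
    - by apply/disjoints_subset; rewrite setCK.
  by move=> /(@uniform_separatorP _ R)[f [cf f01 f0 f1]]; exists f.
have [f fP] := choice Urys.
(* Pairs are listed by their codes; a number that codes no pair gives (0, 0). *)
pose F n := f (odflt (0, 0)%N (unpickle n)).
apply: (family_metrizable R T F) => // [n|n x y|x V oV Vx].
- by have [] := fP (odflt (0, 0)%N (unpickle n)).
- have [_ f01 _] := fP (odflt (0, 0)%N (unpickle n)); rewrite -/(F n) in f01.
  have /andP[x0 x1] : 0 <= F n x <= 1.
    by have := f01 (F n x); rewrite /= in_itv; apply; exists x.
  have /andP[y0 y1] : 0 <= F n y <= 1.
    by have := f01 (F n y); rewrite /= in_itv; apply; exists y.
  by rewrite ler_distl; apply/andP; split; lra.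
- have [m bmx bmV] := bV x V oV Vx.
  have [|W nW Wm] := regT x (b m); first exact: open_nbhs_nbhs.
  have [k bkx bkW] := bV x W° (open_interior W) nW.
  have gkm : good (k, m).
    apply: subset_trans Wm; apply: closureS.
    exact: subset_trans bkW (@interior_subset _ _).
  have [_ _ /(_ gkm)[f0 f1]] := fP (k, m).
  have fx0 : f (k, m) x = 0 by apply: f0; exists x => //; exact: subset_closure.
  exists (pickle (k, m)), 1 => // y; rewrite /F pickleK /= fx0 => fy.
  apply: contrapT => nVy; have fy1 : f (k, m) y = 1.
    by apply: f1; exists y => // /bmV.
  by move: fy; rewrite fy1 sub0r normrN normr1 ltxx.
Qed.

(** Regularity and T1 are expressible by open sets alone, so they pass from the
metric space to the space T, which has the same open sets but another
topological structure. *)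
Lemma metrizable_regular_accessible (R : realType) (T : topologicalType) :
  metrizable R T -> regular_space T /\ accessible_space T.
Proof.
move=> [m mE]; pose M := Metric.Pack m.
split.
  move=> x; apply/regular_openP => A.
  rewrite -openC => /mE; rewrite openC => cA nAx.
  have [U [V [oU oV Ux AV UV]]] :=
    iffLR (regular_openP (x : M)) (@uniform_regular M x) A cA nAx.
  by exists U, V; split=> //; exact/mE.
move=> x y /eqP xy; have xyM : (x : M) != y by apply/eqP => /xy.
have [A [oA Ax Ay]] := hausdorff_accessible (@metric_hausdorff R M) xyM.
by exists A; split=> //; exact/mE.
Qed.

(** * The orbit space *)

Section orbit_space.
Local Open Scope group_scope.
Local Open Scope quotient_scope.
Context {G : groupType} {X : topologicalType} (eta : partial_action G X).

Lemma orbit_space_piP (x y : X) :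
  \pi_(orbit_space eta) x = \pi_(orbit_space eta) y <-> orbit_rel eta x y.
Proof.
split=> [/(@eqmodP _ (orbit_equiv eta))/asboolP//|xy].
by apply/(@eqmodP _ (orbit_equiv eta))/asboolP.
Qed.

(** The saturation of A is the union over g of the preimages of A under
[pact eta g]; each is open in the domain of [pact eta g], which is itself open
in X. *)
Lemma open_orbit_space_pi (A : set X) : topological_partial_action eta ->
  open A -> open (\pi_(orbit_space eta) @` A).
Proof.
move=> teta oA.
have -> : @open (orbit_space eta) (\pi_(orbit_space eta) @` A) =
  open (\pi_(orbit_space eta) @^-1` (\pi_(orbit_space eta) @` A)) by [].
have -> : \pi_(orbit_space eta) @^-1` (\pi_(orbit_space eta) @` A) =
    \bigcup_g (pact_set eta g^-1 `&` pact eta g @^-1` A).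
  apply/seteqP; split=> [x [a Aa /esym/orbit_space_piP[g [gx xa]]]|].
    by exists g => //; split; rewrite /= ?xa// /pact_set /= invgK.
  move=> x [g _ [+ Agx]]; rewrite /pact_set /= invgK => gx.
  by exists (pact eta g x) => //; apply/esym/orbit_space_piP; exists g.
apply: bigcup_open => g _.
have [oXg _] := teta g^-1; have [_ [_ [_ [cg _]]]] := teta g.
rewrite (open_setSI (pact eta g @^-1` A) oXg).
by move/continuousP: cg; exact.
Qed.

End orbit_space.

Theorem proposition3p12 (R : realType) (G : topologicalGroupType)
    (X : topologicalType) (eta : partial_action G X) :
  hausdorff_space G ->
  separable_space X ->
  @second_countable X ->
  topological_partial_action eta ->
  metrizable R (orbit_space eta) <->
  regular_space (orbit_space eta) /\ accessible_space (orbit_space eta).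
Proof.
move=> _ _ scX teta; split; first exact: metrizable_regular_accessible.
move=> [reg acc].
have [b basb] := second_countable_sequential_basis _ scX.
apply: regular_sequential_basis_metrizable reg acc.
apply: (image_sequential_basis _ _ \pi_(orbit_space eta)%qT _ _ _ _ basb).
- exact: pi_continuous.
- by move=> A; exact: open_orbit_space_pi.
- by move=> y; exists (repr y); exact: reprK.
Qed.
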